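(* Let $(q:E\to M,\xi,\lambda)$ be a pre-differential bundle in a tangent category such that: (i) the $n$-fold pullback powers of $q$ exist and are $T$-limits; (ii) the commuting square with top $\lambda:E\to TE$, left $q:E\to M$, right $(T(q),p):TE\to TM\times E$ and bottom $(0,\xi):M\to TM\times E$ is a $T$-pullback. Then there is a uniquely determined addition $+_q:E_2\to E$ making $(q,+_q,\xi)$ an additive bundle and $(\lambda,\xi):q\Rightarrow p$ and $(\lambda,0):q\Rightarrow T(q)$ additive bundle morphisms. Furthermore, when the tangent category has negatives, the additive bundle $(q,+_q,\xi)$ has negatives (i.e. is an abelian group in the slice category over $M$).
   Context: Conventions. Composition is applicative: $gf$ means first $f$, then $g$. For $q:E\to M$, $E_n$ is the $n$-fold fibre product of $E$ over $M$, with projections $\pi_i$. An additive bundle is a commutative monoid $(q:E\to M,\ +_q:E_2\to E,\ \xi:M\to E)$ in the slice category $\mathbb{X}/M$. A morphism of additive bundles is a commutative square $(f_1,f_0)$ from $q$ to $q'$ with $f_1(a+_qb)=f_1a+_{q'}f_1b$ and $f_1\xi=\xi'f_0$. For an endofunctor $T$, a $T$-limit (e.g. $T$-pullback) is a limit diagram preserved by $T^n$ for every $n\geq 0$. If $q$ is an additive bundle whose fibre powers are $T$-limits, $T(q)$ is an additive bundle with addition $+_{T(q)}=T(+_q)$ and zero $T(\xi)$. A tangent category is a category $\mathbb{X}$ with an endofunctor $T$; a natural transformation $p:T\Rightarrow\mathrm{id}$ whose $n$-fold fibre powers $T_n(M)$ of $p_M$ exist and are $T$-limits; and natural transformations $0:\mathrm{id}\Rightarrow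 T$, $+:T_2\Rightarrow T$, $\ell:T\Rightarrow T^2$, $c:T^2\Rightarrow T^2$ such that: each $(p_M,+_M,0_M)$ is an additive bundle; $(\ell,0):(TM,p)\to(T^2M,T(p))$ and $(c,\mathrm{id}):(T^2M,T(p))\to(T^2M,p)$ are additive bundle morphisms; $c^2=\mathrm{id}$, $c\ell=\ell$, $T(\ell)\ell=\ell\ell$, $cT(c)c=T(c)cT(c)$, $T(\ell)c=cT(c)\ell$; and the square with top $\ell\pi_0+_{T(p)}0\pi_1:T_2(M)\to T^2(M)$, left $p\pi_0=p\pi_1:T_2(M)\to M$, right $T(p):T^2(M)\to T(M)$, bottom $0:M\to T(M)$ is a $T$-pullback. It has negatives if there is a natural transformation $-:T\Rightarrow T$ making each $(p_M,0_M,+_M)$ an abelian group bundle. A pre-differential bundle is a triple $(q:E\to M,\xi:M\to E,\lambda:E\to TE)$ with $q\xi=\mathrm{id}$, $\ell\lambda=T(\lambda)\lambda$, $p\lambda=\xi q$, $\lambda\xi=0\xi$. The square in (ii) being a $T$-pullback is read as a limit condition, not requiring the product $TM\times E$ to exist: for every $n\ge 0$, every object $A$, and all $a:A\to T^{n+1}E$, $m:A\to T^nM$ with $T^{n+1}(q)a=T^n(0)m$ and $T^n(p)a=T^n(\xi)m$, there is a unique $e:A\to T^nE$ with $T^n(\lambda)e=a$ and $T^n(q)e=m$. *)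

(* Defs.v *)
From mathcomp Require Import all_boot.

Set Implicit Arguments.
Unset Strict Implicit.
Unset Printing Implicit Defensive.

Declare Scope cat_scope.
Delimit Scope cat_scope with cat.
Local Open Scope cat_scope.

Record category := Category {
  obj :> Type;
  hom : obj -> obj -> Type;
  idm : forall A : obj, hom A A;
  compm : forall A B C : obj, hom B C -> hom A B -> hom A C;
  compm1 : forall (A B : obj) (f : hom A B), compm f (idm A) = f;
  comp1m : forall (A B : obj) (f : hom A B), compm (idm B) f = f;
  compmA : forall (A B C D : obj) (h : hom C D) (g : hom B C) (f : hom A B),
    compm h (compm g f) = compm (compm h g) f
}.

Arguments hom {c} _ _.
Arguments idm {c} _.
Arguments compm {c A B C} _ _.

(* applicative order: first f, then g *)
Notation "g ∘ f" := (compm g f) (at level 40, left associativity) : cat_scope.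

Record functor (X Y : category) := Functor {
  fobj :> X -> Y;
  fmap : forall A B : X, hom A B -> hom (fobj A) (fobj B);
  fmap1 : forall A : X, fmap (idm A) = idm (fobj A);
  fmapM : forall (A B C : X) (g : hom B C) (f : hom A B),
    fmap (g ∘ f) = fmap g ∘ fmap f
}.

Arguments fmap {X Y} _ {A B} _.

Definition idF (X : category) : functor X X :=
  @Functor X X (fun A => A) (fun A B f => f)
    (fun A => erefl) (fun A B C g f => erefl).

Lemma compF_fmap1 (X Y Z : category) (G : functor Y Z) (F : functor X Y) (A : X) :
  fmap G (fmap F (idm A)) = idm (G (F A)).
Proof. by rewrite !fmap1. Qed.

Lemma compF_fmapM (X Y Z : category) (G : functor Y Z) (F : functor X Y)
    (A B C : X) (g : hom B C) (f : hom A B) :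
  fmap G (fmap F (g ∘ f)) = fmap G (fmap F g) ∘ fmap G (fmap F f).
Proof. by rewrite !fmapM. Qed.

Definition compF (X Y Z : category) (G : functor Y Z) (F : functor X Y) :
    functor X Z :=
  @Functor X Z (fun A => G (F A)) (fun A B f => fmap G (fmap F f))
    (compF_fmap1 G F) (compF_fmapM G F).

Fixpoint iterF (X : category) (T : functor X X) (n : nat) : functor X X :=
  if n is m.+1 then compF T (iterF T m) else idF X.

Definition natural (X Y : category) (F G : functor X Y)
    (a : forall A : X, hom (F A) (G A)) : Prop :=
  forall (A B : X) (f : hom A B), a B ∘ fmap F f = fmap G f ∘ a A.

Definition is_pullback (X : category) (P B C D : X)
    (f : hom P B) (g : hom P C) (h : hom B D) (k : hom C D) : Prop :=
  h ∘ f = k ∘ g /\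
  forall (A : X) (b : hom A B) (c : hom A C), h ∘ b = k ∘ c ->
    exists! u : hom A P, f ∘ u = b /\ g ∘ u = c.

Definition is_T_pullback (X : category) (T : functor X X) (P B C D : X)
    (f : hom P B) (g : hom P C) (h : hom B D) (k : hom C D) : Prop :=
  forall n : nat,
    is_pullback (fmap (iterF T n) f) (fmap (iterF T n) g)
                (fmap (iterF T n) h) (fmap (iterF T n) k).

(* The candidate [E_n]: the map [pbase] to M is part of the cone, so that the
   0-fold power of q is M up to isomorphism. *)
Record power_cone (X : category) (E M : X) (n : nat) := PowerCone {
  papex :> X;
  pbase : hom papex M;
  pproj : 'I_n -> hom papex E
}.

Definition is_fibre_power (X : category) (E M : X) (q : hom E M) (n : nat)
    (P : power_cone E M n) : Prop :=
  (forall i : 'I_n, q ∘ pproj P i = pbase P) /\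
  forall (A : X) (m : hom A M) (e : 'I_n -> hom A E),
    (forall i : 'I_n, q ∘ e i = m) ->
    exists! u : hom A P, pbase P ∘ u = m /\ forall i : 'I_n, pproj P i ∘ u = e i.

Definition fmap_cone (X Y : category) (F : functor X Y) (E M : X) (n : nat)
    (P : power_cone E M n) : power_cone (F E) (F M) n :=
  PowerCone (fmap F (pbase P)) (fun i => fmap F (pproj P i)).

Definition is_T_fibre_power (X : category) (T : functor X X) (E M : X)
    (q : hom E M) (n : nat) (P : power_cone E M n) : Prop :=
  forall k : nat, is_fibre_power (fmap (iterF T k) q) (fmap_cone (iterF T k) P).

Definition pi0 (X : category) (E M : X) (P : power_cone E M 2) : hom P E :=
  pproj P ord0.
Definition pi1 (X : category) (E M : X) (P : power_cone E M 2) : hom P E :=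
  pproj P ord_max.

Record bundle_data (X : category) := BundleData {
  btot : X;
  bbase : X;
  bproj : hom btot bbase;
  bpow2 : power_cone btot bbase 2;
  badd : hom bpow2 btot;
  bzero : hom bbase btot
}.

Arguments BundleData {X btot bbase} bproj bpow2 badd bzero.

(* [is_sum D a b s] is "a + b is defined and equals s" on generalised elements:
   s is [badd D] after the pairing of a and b.  When [bpow2 D] is a fibre
   product, s exists iff a and b lie over the same map, and is then unique. *)
Definition is_sum (X : category) (D : bundle_data X) (A : X)
    (a b s : hom A (btot D)) : Prop :=
  exists u : hom A (bpow2 D),
    [/\ pi0 (bpow2 D) ∘ u = a, pi1 (bpow2 D) ∘ u = b & badd D ∘ u = s].

(* commutative monoid in the slice over [bbase D], on generalised elements *)
Record is_additive_bundle (X : category) (D : bundle_data X) : Prop := {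
  ab_pow2 : is_fibre_power (bproj D) (bpow2 D);
  ab_add_over : bproj D ∘ badd D = pbase (bpow2 D);
  ab_zero_over : bproj D ∘ bzero D = idm (bbase D);
  ab_addC : forall (A : X) (a b s : hom A (btot D)),
    is_sum a b s -> is_sum b a s;
  ab_addA : forall (A : X) (a b c s t : hom A (btot D)),
    is_sum a b s -> is_sum s c t ->
    exists r : hom A (btot D), is_sum b c r /\ is_sum a r t;
  ab_add0 : forall (A : X) (a : hom A (btot D)),
    is_sum (bzero D ∘ (bproj D ∘ a)) a a
}.

(* [n] is the inversion of a group structure in the slice over [bbase D] *)
Definition is_negation (X : category) (D : bundle_data X)
    (n : hom (btot D) (btot D)) : Prop :=
  bproj D ∘ n = bproj D /\
  forall (A : X) (a : hom A (btot D)),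
    is_sum a (n ∘ a) (bzero D ∘ (bproj D ∘ a)).

Definition is_abelian_group_bundle (X : category) (D : bundle_data X)
    (n : hom (btot D) (btot D)) : Prop :=
  is_additive_bundle D /\ is_negation n.

Record is_additive_morphism (X : category) (D D' : bundle_data X)
    (f1 : hom (btot D) (btot D')) (f0 : hom (bbase D) (bbase D')) : Prop := {
  am_square : bproj D' ∘ f1 = f0 ∘ bproj D;
  am_add : forall (A : X) (a b s : hom A (btot D)),
    is_sum a b s -> is_sum (f1 ∘ a) (f1 ∘ b) (f1 ∘ s);
  am_zero : f1 ∘ bzero D = bzero D' ∘ f0
}.

Arguments is_additive_morphism {X} D D' f1 f0.

(* T(q), with addition T(+) and zero T(xi); its binary fibre power is T(E_2) *)
Definition fmap_bundle (X Y : category) (F : functor X Y) (D : bundle_data X) :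
    bundle_data Y :=
  @BundleData Y (F (btot D)) (F (bbase D)) (fmap F (bproj D))
    (fmap_cone F (bpow2 D)) (fmap F (badd D)) (fmap F (bzero D)).

Record tangent_data (X : category) := TangentData {
  tanF : functor X X;
  tp : forall M : X, hom (tanF M) M;
  tpow : forall (M : X) (n : nat), power_cone (tanF M) M n;
  tzero : forall M : X, hom M (tanF M);
  tadd : forall M : X, hom (tpow M 2) (tanF M);
  tlift : forall M : X, hom (tanF M) (tanF (tanF M));
  tflip : forall M : X, hom (tanF (tanF M)) (tanF (tanF M))
}.

Definition tangent_bundle (X : category) (S : tangent_data X) (M : X) :
    bundle_data X :=
  BundleData (tp S M) (tpow S M 2) (tadd S M) (tzero S M).

Record is_tangent_structure (X : category) (S : tangent_data X) : Prop := {
  tp_nat : natural (F := tanF S) (G := idF X) (tp S);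
  tpow_T_limit : forall (M : X) (n : nat),
    is_T_fibre_power (tanF S) (tp S M) (tpow S M n);
  tzero_nat : natural (F := idF X) (G := tanF S) (tzero S);
  (* f2 is T_2(f) *)
  tadd_nat : forall (M N : X) (f : hom M N) (f2 : hom (tpow S M 2) (tpow S N 2)),
    (forall i : 'I_2,
       pproj (tpow S N 2) i ∘ f2 = fmap (tanF S) f ∘ pproj (tpow S M 2) i) ->
    tadd S N ∘ f2 = fmap (tanF S) f ∘ tadd S M;
  tlift_nat : natural (F := tanF S) (G := compF (tanF S) (tanF S)) (tlift S);
  tflip_nat : natural (F := compF (tanF S) (tanF S))
                      (G := compF (tanF S) (tanF S)) (tflip S);
  tangent_bundle_additive : forall M : X, is_additive_bundle (tangent_bundle S M);
  tlift_additive : forall M : X,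
    is_additive_morphism (tangent_bundle S M)
      (fmap_bundle (tanF S) (tangent_bundle S M)) (tlift S M) (tzero S M);
  tflip_additive : forall M : X,
    is_additive_morphism (fmap_bundle (tanF S) (tangent_bundle S M))
      (tangent_bundle S (tanF S M)) (tflip S M) (idm (tanF S M));
  tflipK : forall M : X, tflip S M ∘ tflip S M = idm (tanF S (tanF S M));
  tflip_lift : forall M : X, tflip S M ∘ tlift S M = tlift S M;
  tlift_lift : forall M : X,
    fmap (tanF S) (tlift S M) ∘ tlift S M = tlift S (tanF S M) ∘ tlift S M;
  tflip_braid : forall M : X,
    tflip S (tanF S M) ∘ fmap (tanF S) (tflip S M) ∘ tflip S (tanF S M)
    = fmap (tanF S) (tflip S M) ∘ tflip S (tanF S M) ∘ fmap (tanF S) (tflip S M);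
  tlift_flip : forall M : X,
    fmap (tanF S) (tlift S M) ∘ tflip S M
    = tflip S (tanF S M) ∘ fmap (tanF S) (tflip S M) ∘ tlift S (tanF S M);
  tlift_universal : forall M : X,
    exists v : hom (tpow S M 2) (tanF S (tanF S M)),
      is_sum (D := fmap_bundle (tanF S) (tangent_bundle S M))
        (tlift S M ∘ pi0 (tpow S M 2)) (tzero S (tanF S M) ∘ pi1 (tpow S M 2)) v /\
      is_T_pullback (tanF S) v (tp S M ∘ pi0 (tpow S M 2))
        (fmap (tanF S) (tp S M)) (tzero S M)
}.

Record tangent_category := TangentCategory {
  tcat :> category;
  tstruct :> tangent_data tcat;
  tstructP : is_tangent_structure tstruct
}.

Definition has_negatives (X : tangent_category) : Prop :=
  exists neg : forall M : X, hom (tanF X M) (tanF X M),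
    natural (F := tanF X) (G := tanF X) neg /\
    forall M : X, is_abelian_group_bundle (D := tangent_bundle X M) (neg M).

Record is_pre_differential_bundle (X : tangent_category) (E M : X)
    (q : hom E M) (xi : hom M E) (lam : hom E (tanF X E)) : Prop := {
  pdb_section : q ∘ xi = idm M;
  pdb_lift : tlift X E ∘ lam = fmap (tanF X) lam ∘ lam;
  pdb_proj : tp X E ∘ lam = xi ∘ q;
  pdb_zero : lam ∘ xi = tzero X E ∘ xi
}.

(* The square of lam and q over (T(q), p) and (0, xi) is a T-pullback, stated
   without the product TM x E.  Here T^(n+1) E is presented as T^n (T E). *)
Definition lift_is_T_pullback (X : tangent_category) (E M : X)
    (q : hom E M) (xi : hom M E) (lam : hom E (tanF X E)) : Prop :=
  forall (n : nat) (A : X)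
    (a : hom A (iterF (tanF X) n (tanF X E))) (m : hom A (iterF (tanF X) n M)),
    fmap (iterF (tanF X) n) (fmap (tanF X) q) ∘ a
      = fmap (iterF (tanF X) n) (tzero X M) ∘ m ->
    fmap (iterF (tanF X) n) (tp X E) ∘ a = fmap (iterF (tanF X) n) xi ∘ m ->
    exists! e : hom A (iterF (tanF X) n E),
      fmap (iterF (tanF X) n) lam ∘ e = a /\ fmap (iterF (tanF X) n) q ∘ e = m.

Definition is_compatible_addition (X : tangent_category) (E M : X)
    (q : hom E M) (xi : hom M E) (lam : hom E (tanF X E))
    (E2 : power_cone E M 2) (add : hom E2 E) : Prop :=
  [/\ is_additive_bundle (BundleData q E2 add xi),
      is_additive_morphism (BundleData q E2 add xi) (tangent_bundle X E) lam xi
    & is_additive_morphism (BundleData q E2 add xi)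
        (fmap_bundle (tanF X) (BundleData q E2 add xi)) lam (tzero X M)].

(* Main.v *)
Require Import Defs.
From mathcomp Require Import all_boot.

(** The universal property of the lift says that lam is monic, and that
    a : A -> TE factors through lam exactly when it is vertical over a zero
    vector and based at a zero, that is, [T(q) a = 0 m] and [p a = xi m] for
    some m ([lift_monic], [lift_factor]).  Such tangent vectors are closed
    under the addition of the tangent bundle of E, and under its negation if
    there is one, because both operations are natural in E and preserve zero
    vectors.  So the operations of p : TE -> E restrict along lam to the fibres
    of q ([lift_addition_exists], [lift_negation_exists]).  Every equation
    between them holds in TE, hence in E because lam is monic
    ([additive_bundle_reflect], [negation_reflect]); for the same reason lam
    leaves no choice for the addition.

    The additivity of (lam, 0) : q -> T(q) is the one point where the lift
    [l : T -> T^2] enters.  T(lam) is also monic, so it is enough to compare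
    after T(lam); there T(lam) lam = l lam, and l and lam take sums over E to
    sums for T(p), as does T(lam) for T(q) ([additive_morphism_cancel]). *)

Set Implicit Arguments.
Unset Strict Implicit.
Unset Printing Implicit Defensive.

Local Open Scope cat_scope.

(** * Binary fibre powers and sums of generalised elements *)

Definition monic (X : category) (B C : X) (f : hom B C) : Prop :=
  forall (A : X) (a b : hom A B), f ∘ a = f ∘ b -> a = b.

Lemma ord2_ind (P : 'I_2 -> Prop) : P ord0 -> P ord_max -> forall i, P i.
Proof.
move=> P0 P1 [[|[|i]] lti] //.
- by rewrite (_ : Ordinal lti = ord0) //; apply: val_inj.
- by rewrite (_ : Ordinal lti = ord_max) //; apply: val_inj.
Qed.

Lemma fibre_power_over (X : category) (E M : X) (q : hom E M)
    (P : power_cone E M 2) (A : X) (u : hom A P) :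
  is_fibre_power q P ->
  q ∘ (pi0 P ∘ u) = pbase P ∘ u /\ q ∘ (pi1 P ∘ u) = pbase P ∘ u.
Proof. by case=> qP _; rewrite !compmA !qP. Qed.

Lemma fibre_pair (X : category) (E M : X) (q : hom E M)
    (P : power_cone E M 2) (A : X) (a b : hom A E) :
  is_fibre_power q P -> q ∘ a = q ∘ b ->
  exists u : hom A P, pi0 P ∘ u = a /\ pi1 P ∘ u = b.
Proof.
move=> [_ univ] qab.
pose e (i : 'I_2) := if i == ord0 then a else b.
have [|u [[_ ue] _]] := univ A (q ∘ a) e; first exact: ord2_ind.
by exists u; split; [exact: (ue ord0) | exact: (ue ord_max)].
Qed.

Lemma fibre_pair_inj (X : category) (E M : X) (q : hom E M)
    (P : power_cone E M 2) (A : X) (u v : hom A P) :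
  is_fibre_power q P ->
  pi0 P ∘ u = pi0 P ∘ v -> pi1 P ∘ u = pi1 P ∘ v -> u = v.
Proof.
move=> fpP uv0 uv1; have [qP univ] := fpP.
have base_uv : pbase P ∘ u = pbase P ∘ v.
  by rewrite -(fibre_power_over u fpP).1 uv0 (fibre_power_over v fpP).1.
have [|w [_ w_uniq]] := univ A (pbase P ∘ v) (fun i => pproj P i ∘ v).
  by move=> i; rewrite compmA qP.
rewrite -(w_uniq v) //; symmetry; apply: w_uniq; split=> //.
exact: ord2_ind.
Qed.

Lemma is_sum_generic (X : category) (D : bundle_data X) :
  is_sum (pi0 (bpow2 D)) (pi1 (bpow2 D)) (badd D).
Proof. by exists (idm _); rewrite !compm1. Qed.

Lemma is_sum_comp (X : category) (D : bundle_data X) (A B : X)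
    (a b s : hom B (btot D)) (f : hom A B) :
  is_sum a b s -> is_sum (a ∘ f) (b ∘ f) (s ∘ f).
Proof. by move=> [u [<- <- <-]]; exists (u ∘ f); rewrite !compmA. Qed.

Lemma is_sum_exists (X : category) (D : bundle_data X) (A : X)
    (a b : hom A (btot D)) :
  is_fibre_power (bproj D) (bpow2 D) -> bproj D ∘ a = bproj D ∘ b ->
  exists s, is_sum a b s.
Proof.
move=> fpD /(fibre_pair fpD) [u [ua ub]].
by exists (badd D ∘ u), u.
Qed.

Lemma is_sum_unique (X : category) (D : bundle_data X) (A : X)
    (a b s t : hom A (btot D)) :
  is_fibre_power (bproj D) (bpow2 D) ->
  is_sum a b s -> is_sum a b t -> s = t.
Proof.
move=> fpD [u [ua ub <-]] [v [va vb <-]].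
by congr (_ ∘ _); apply: (fibre_pair_inj fpD); [rewrite ua va | rewrite ub vb].
Qed.

Lemma is_sum_summands_over (X : category) (D : bundle_data X) (A : X)
    (a b s : hom A (btot D)) :
  is_fibre_power (bproj D) (bpow2 D) -> is_sum a b s ->
  bproj D ∘ a = bproj D ∘ b.
Proof.
move=> fpD [u [<- <- _]].
by have [-> ->] := fibre_power_over u fpD.
Qed.

Lemma is_sum_over (X : category) (D : bundle_data X) (A : X)
    (a b s : hom A (btot D)) :
  is_fibre_power (bproj D) (bpow2 D) ->
  bproj D ∘ badd D = pbase (bpow2 D) -> is_sum a b s ->
  bproj D ∘ s = bproj D ∘ a.
Proof.
move=> fpD add_over [u [<- _ <-]].
by rewrite compmA add_over (fibre_power_over u fpD).1.
Qed.

Lemma additive_sum_zero_zero (X : category) (D : bundle_data X) (A : X)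
    (m : hom A (bbase D)) :
  is_additive_bundle D -> is_sum (bzero D ∘ m) (bzero D ∘ m) (bzero D ∘ m).
Proof.
move=> abD; have := ab_add0 abD (bzero D ∘ m).
by rewrite (compmA (bproj D)) (ab_zero_over abD) comp1m.
Qed.

Lemma negation_zero (X : category) (D : bundle_data X)
    (n : hom (btot D) (btot D)) (A : X) (m : hom A (bbase D)) :
  is_abelian_group_bundle n -> n ∘ (bzero D ∘ m) = bzero D ∘ m.
Proof.
move=> [abD [n_over addn]].
have proj_zero : bproj D ∘ (bzero D ∘ m) = m.
  by rewrite compmA (ab_zero_over abD) comp1m.
have := addn A (bzero D ∘ m); have := ab_add0 abD (n ∘ (bzero D ∘ m)).
rewrite (compmA (bproj D) n) n_over proj_zero; exact: is_sum_unique (ab_pow2 abD).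
Qed.

(** * Additive morphisms *)

(** By the Yoneda argument, preservation of the sum of the two projections of
    the fibre product is preservation of all sums. *)
Lemma preserves_generic_sum (X : category) (D D' : bundle_data X)
    (f : hom (btot D) (btot D')) :
  is_sum (f ∘ pi0 (bpow2 D)) (f ∘ pi1 (bpow2 D)) (f ∘ badd D) ->
  forall (A : X) (a b s : hom A (btot D)),
    is_sum a b s -> is_sum (f ∘ a) (f ∘ b) (f ∘ s).
Proof.
move=> sum_f A a b s [u [<- <- <-]].
by rewrite !compmA; exact: is_sum_comp.
Qed.

(** The factorisation of the generic sum through the fibre product of D' is a
    morphism, and its image under F is the factorisation asked for. *)
Lemma fmap_additive_morphism (X Y : category) (F : functor X Y)
    (D D' : bundle_data X) (f : hom (btot D) (btot D'))
    (f0 : hom (bbase D) (bbase D')) :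
  is_additive_morphism D D' f f0 ->
  is_additive_morphism (fmap_bundle F D) (fmap_bundle F D')
    (fmap F f) (fmap F f0).
Proof.
move=> amf; split=> /=.
- by rewrite -!fmapM (am_square amf).
- apply: (@preserves_generic_sum Y (fmap_bundle F D) (fmap_bundle F D')).
  have [v [v0 v1 vs]] := am_add amf (is_sum_generic D).
  exists (fmap F v); rewrite /pi0 /pi1 /= -!fmapM.
  by split; congr (fmap F _).
- by rewrite -!fmapM (am_zero amf).
Qed.

Lemma additive_morphism_comp (X : category) (D D' D'' : bundle_data X)
    (g : hom (btot D') (btot D'')) (g0 : hom (bbase D') (bbase D''))
    (f : hom (btot D) (btot D')) (f0 : hom (bbase D) (bbase D')) :
  is_additive_morphism D' D'' g g0 -> is_additive_morphism D D' f f0 ->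
  is_additive_morphism D D'' (g ∘ f) (g0 ∘ f0).
Proof.
move=> amg amf; split.
- by rewrite compmA (am_square amg) -compmA (am_square amf) compmA.
- by move=> A a b s /(am_add amf) /(am_add amg); rewrite !compmA.
- by rewrite -compmA (am_zero amf) compmA (am_zero amg) -compmA.
Qed.

(** A monic additive morphism reflects sums, since the sum of a and b exists
    in D and its image is the sum of the images. *)
Lemma is_sum_reflect (X : category) (D D' : bundle_data X)
    (f : hom (btot D) (btot D')) (f0 : hom (bbase D) (bbase D')) (A : X)
    (a b s : hom A (btot D)) :
  is_fibre_power (bproj D) (bpow2 D) ->
  is_fibre_power (bproj D') (bpow2 D') ->
  monic f -> is_additive_morphism D D' f f0 ->
  bproj D ∘ a = bproj D ∘ b ->
  is_sum (f ∘ a) (f ∘ b) (f ∘ s) -> is_sum a b s.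
Proof.
move=> fpD fpD' mono_f amf qab sum_f.
have [t sum_t] := is_sum_exists fpD qab.
suff -> : s = t by [].
exact/mono_f/(is_sum_unique fpD' sum_f)/(am_add amf).
Qed.

(** Commutativity, associativity and the unit law are equations between sums,
    which a monic additive morphism reflects. *)
Lemma additive_bundle_reflect (X : category) (D D' : bundle_data X)
    (f : hom (btot D) (btot D')) (f0 : hom (bbase D) (bbase D')) :
  is_fibre_power (bproj D) (bpow2 D) ->
  bproj D ∘ badd D = pbase (bpow2 D) ->
  bproj D ∘ bzero D = idm (bbase D) ->
  is_additive_bundle D' -> monic f -> is_additive_morphism D D' f f0 ->
  is_additive_bundle D.
Proof.
move=> fpD add_over zero_over abD' mono_f amf.
have reflect := is_sum_reflect fpD (ab_pow2 abD') mono_f amf.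
have over := is_sum_over fpD add_over.
split=> // [A a b s sum_ab | A a b c s t sum_ab sum_sc | A a].
- apply: reflect; first by rewrite (is_sum_summands_over fpD sum_ab).
  exact/(ab_addC abD')/(am_add amf).
- have qsc := is_sum_summands_over fpD sum_sc.
  have qab := is_sum_summands_over fpD sum_ab.
  have qsa := over _ _ _ _ sum_ab.
  have [|r sum_bc] := @is_sum_exists _ D _ b c fpD.
    by rewrite -qab -qsa.
  exists r; split=> //; apply: reflect.
    by rewrite (over _ _ _ _ sum_bc).
  have [r' [sum_r' sum_ar']] :=
    ab_addA abD' (am_add amf sum_ab) (am_add amf sum_sc).
  by rewrite (is_sum_unique (ab_pow2 abD') (am_add amf sum_bc) sum_r').
- apply: reflect; first by rewrite compmA zero_over comp1m.
  rewrite compmA (am_zero amf) -compmA (compmA f0) -(am_square amf) -compmA.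
  exact: ab_add0.
Qed.

Lemma negation_reflect (X : category) (D D' : bundle_data X)
    (f : hom (btot D) (btot D')) (f0 : hom (bbase D) (bbase D'))
    (n : hom (btot D) (btot D)) (n' : hom (btot D') (btot D')) :
  is_fibre_power (bproj D) (bpow2 D) ->
  is_fibre_power (bproj D') (bpow2 D') ->
  monic f -> is_additive_morphism D D' f f0 ->
  bproj D ∘ n = bproj D -> f ∘ n = n' ∘ f -> is_negation n' -> is_negation n.
Proof.
move=> fpD fpD' mono_f amf n_over fn [_ addn']; split=> // A a.
apply: (is_sum_reflect fpD fpD' mono_f amf); first by rewrite compmA n_over.
have := addn' A (f ∘ a).
rewrite (compmA n') -fn (compmA (bproj D')) (am_square amf).
by rewrite !compmA (am_zero amf).
Qed.

(** The sum of f a and f b exists in D', since f lies over f0; composing with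
    the monic g identifies it as f (a + b). *)
Lemma additive_morphism_cancel (X : category) (D D' D'' : bundle_data X)
    (g : hom (btot D') (btot D'')) (g0 : hom (bbase D') (bbase D''))
    (f : hom (btot D) (btot D')) (f0 : hom (bbase D) (bbase D'))
    (h0 : hom (bbase D) (bbase D'')) :
  is_fibre_power (bproj D) (bpow2 D) ->
  is_fibre_power (bproj D') (bpow2 D') ->
  is_fibre_power (bproj D'') (bpow2 D'') ->
  monic g -> is_additive_morphism D' D'' g g0 ->
  bproj D' ∘ f = f0 ∘ bproj D -> f ∘ bzero D = bzero D' ∘ f0 ->
  is_additive_morphism D D'' (g ∘ f) h0 ->
  is_additive_morphism D D' f f0.
Proof.
move=> fpD fpD' fpD'' mono_g amg sq zero amgf; split=> // A a b s sum_ab.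
apply: (is_sum_reflect fpD' fpD'' mono_g amg).
  by rewrite !compmA sq -!compmA (is_sum_summands_over fpD sum_ab).
by rewrite !compmA; exact: am_add amgf _ _ _ _ sum_ab.
Qed.

(** * Addition of tangent vectors *)

Lemma tangent_map_additive (X : tangent_category) (M N : X) (f : hom M N) :
  is_additive_morphism (tangent_bundle X M) (tangent_bundle X N)
    (fmap (tanF X) f) f.
Proof.
have HX := tstructP X.
have pf : tp X N ∘ fmap (tanF X) f = f ∘ tp X M := tp_nat HX f.
have fpM := ab_pow2 (tangent_bundle_additive HX M).
have fpN := ab_pow2 (tangent_bundle_additive HX N).
split=> //=; last by rewrite -(tzero_nat HX f).
apply: (@preserves_generic_sum _ (tangent_bundle X M) (tangent_bundle X N)) => /=.
have [|f2 [f2_0 f2_1]] := @fibre_pair _ _ _ _ _ _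
    (fmap (tanF X) f ∘ pi0 (tpow X M 2)) (fmap (tanF X) f ∘ pi1 (tpow X M 2)) fpN.
  rewrite /= !compmA pf -!compmA; congr (_ ∘ _).
  exact: (is_sum_summands_over fpM (is_sum_generic (tangent_bundle X M))).
exists f2; split=> //; apply: (tadd_nat HX).
exact: ord2_ind.
Qed.

Lemma fmap_tangent_fibre_power (X : tangent_category) (M : X) :
  is_fibre_power (fmap (tanF X) (tp X M)) (fmap_cone (tanF X) (tpow X M 2)).
Proof. exact: (tpow_T_limit (tstructP X) M 2 1). Qed.

(** * The lift of a pre-differential bundle *)

(** This is recovered from the compatibility of lam with the lift l of the
    tangent structure: composing [l lam = T(lam) lam] with T(p) gives
    [0 xi q = T(xi) T(q) lam], and T(xi) has the retraction T(q). *)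
Lemma lift_vertical (X : tangent_category) (E M : X) (q : hom E M)
    (xi : hom M E) (lam : hom E (tanF X E)) :
  is_pre_differential_bundle q xi lam ->
  fmap (tanF X) q ∘ lam = tzero X M ∘ q.
Proof.
move=> pdb; have HX := tstructP X.
have Tp_l : fmap (tanF X) (tp X E) ∘ tlift X E = tzero X E ∘ tp X E :=
  am_square (tlift_additive HX E).
have zero_xi : tzero X E ∘ xi = fmap (tanF X) xi ∘ tzero X M :=
  tzero_nat HX xi.
have : fmap (tanF X) (tp X E) ∘ (tlift X E ∘ lam)
     = fmap (tanF X) (tp X E) ∘ (fmap (tanF X) lam ∘ lam).
  by rewrite (pdb_lift pdb).
rewrite !compmA Tp_l -fmapM -compmA (pdb_proj pdb) compmA zero_xi fmapM => eq_xi.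
have := congr1 (compm (fmap (tanF X) q)) eq_xi.
by rewrite !compmA -fmapM (pdb_section pdb) fmap1 !comp1m.
Qed.

(** The projection q is recovered from lam by [q p lam = q], so the
    uniqueness in the universal property is about lam alone. *)
Lemma lift_monic (X : tangent_category) (E M : X) (q : hom E M)
    (xi : hom M E) (lam : hom E (tanF X E)) (n : nat) :
  is_pre_differential_bundle q xi lam -> lift_is_T_pullback q xi lam ->
  monic (fmap (iterF (tanF X) n) lam).
Proof.
move=> pdb hlam A a b lam_ab.
have q_lam : q ∘ tp X E ∘ lam = q.
  by rewrite -compmA (pdb_proj pdb) compmA (pdb_section pdb) comp1m.
have q_ab : fmap (iterF (tanF X) n) q ∘ a = fmap (iterF (tanF X) n) q ∘ b.
  by rewrite -q_lam fmapM -!compmA lam_ab.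
have [||e [_ e_uniq]] := hlam n A (fmap (iterF (tanF X) n) lam ∘ a)
                              (fmap (iterF (tanF X) n) q ∘ a).
- by rewrite !compmA -!fmapM (lift_vertical pdb).
- by rewrite !compmA -!fmapM (pdb_proj pdb).
by rewrite -(e_uniq a) // -(e_uniq b).
Qed.

Lemma lift_factor (X : tangent_category) (E M : X) (q : hom E M)
    (xi : hom M E) (lam : hom E (tanF X E)) (A : X)
    (a : hom A (tanF X E)) (m : hom A M) :
  lift_is_T_pullback q xi lam ->
  fmap (tanF X) q ∘ a = tzero X M ∘ m -> tp X E ∘ a = xi ∘ m ->
  exists e : hom A E, lam ∘ e = a /\ q ∘ e = m.
Proof. by move=> hlam qa pa; have [e [? _]] := hlam 0 A a m qa pa; exists e. Qed.

(** The sum of lam e0 and lam e1 in TE is again vertical over a zero vector,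
    because T(q) is additive and 0 + 0 = 0. *)
Lemma lift_addition_exists (X : tangent_category) (E M : X) (q : hom E M)
    (xi : hom M E) (lam : hom E (tanF X E)) (E2 : power_cone E M 2) :
  is_pre_differential_bundle q xi lam -> is_fibre_power q E2 ->
  lift_is_T_pullback q xi lam ->
  exists add : hom E2 E, q ∘ add = pbase E2 /\
    is_additive_morphism (BundleData q E2 add xi) (tangent_bundle X E) lam xi.
Proof.
move=> pdb fpE2 hlam; have abT := tangent_bundle_additive (tstructP X).
have q0 : q ∘ pi0 E2 = pbase E2 := fpE2.1 ord0.
have q1 : q ∘ pi1 E2 = pbase E2 := fpE2.1 ord_max.
have p_lam (A : X) (e : hom A E) : tp X E ∘ (lam ∘ e) = xi ∘ (q ∘ e).
  by rewrite !compmA (pdb_proj pdb).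
have Tq_lam (A : X) (e : hom A E) :
    fmap (tanF X) q ∘ (lam ∘ e) = tzero X M ∘ (q ∘ e).
  by rewrite !compmA (lift_vertical pdb).
have [|s sum_s] := @is_sum_exists _ (tangent_bundle X E) _
    (lam ∘ pi0 E2) (lam ∘ pi1 E2) (ab_pow2 (abT E)).
  by rewrite /= !p_lam q0 q1.
have [||add [lam_add q_add]] := @lift_factor _ _ _ _ _ _ _ s (pbase E2) hlam.
- have := am_add (tangent_map_additive q) sum_s.
  rewrite !Tq_lam q0 q1 => /(is_sum_unique (ab_pow2 (abT M))); apply.
  exact: (additive_sum_zero_zero _ (abT M)).
- have := is_sum_over (ab_pow2 (abT E)) (ab_add_over (abT E)) sum_s.
  by rewrite /= p_lam q0.
exists add; split=> //; split=> /=; rewrite ?(pdb_proj pdb) ?(pdb_zero pdb) //.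
apply: (@preserves_generic_sum _ (BundleData q E2 add xi) (tangent_bundle X E)).
by rewrite /= lam_add.
Qed.

Lemma lift_negation_exists (X : tangent_category) (E M : X) (q : hom E M)
    (xi : hom M E) (lam : hom E (tanF X E))
    (neg : forall M : X, hom (tanF X M) (tanF X M)) :
  is_pre_differential_bundle q xi lam -> lift_is_T_pullback q xi lam ->
  natural (F := tanF X) (G := tanF X) neg ->
  (forall M : X, is_abelian_group_bundle (D := tangent_bundle X M) (neg M)) ->
  exists n : hom E E, lam ∘ n = neg E ∘ lam /\ q ∘ n = q.
Proof.
move=> pdb hlam neg_nat neg_grp; apply: lift_factor hlam _ _.
- rewrite compmA -neg_nat -compmA (lift_vertical pdb).
  exact: (negation_zero _ (neg_grp M)).
- have [_ [p_neg _]] := neg_grp E.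
  by rewrite compmA p_neg (pdb_proj pdb).
Qed.

Lemma lift_additive_over_zero (X : tangent_category) (E M : X) (q : hom E M)
    (xi : hom M E) (lam : hom E (tanF X E)) (E2 : power_cone E M 2)
    (add : hom E2 E) :
  is_pre_differential_bundle q xi lam -> is_T_fibre_power (tanF X) q E2 ->
  lift_is_T_pullback q xi lam ->
  is_additive_morphism (BundleData q E2 add xi) (tangent_bundle X E) lam xi ->
  is_additive_morphism (BundleData q E2 add xi)
    (fmap_bundle (tanF X) (BundleData q E2 add xi)) lam (tzero X M).
Proof.
move=> pdb fpE2 hlam am_lam; have HX := tstructP X.
apply: (additive_morphism_cancel _ _ _ _ (fmap_additive_morphism (tanF X) am_lam)).
- exact: (fpE2 0).
- exact: (fpE2 1).
- exact: fmap_tangent_fibre_power.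
- exact: (lift_monic (n := 1) pdb hlam).
- exact: lift_vertical pdb.
- by rewrite /= (pdb_zero pdb); exact: (tzero_nat HX xi).
have := additive_morphism_comp (tlift_additive HX E) am_lam.
rewrite (pdb_lift pdb); exact.
Qed.

Theorem lemma2p2p1 (X : tangent_category) (E M : X)
    (q : hom E M) (xi : hom M E) (lam : hom E (tanF X E))
    (hpre : is_pre_differential_bundle q xi lam)
    (Epow : forall n : nat, power_cone E M n)
    (hpow : forall n : nat, is_T_fibre_power (tanF X) q (Epow n))
    (hlam : lift_is_T_pullback q xi lam) :
  (exists! add : hom (Epow 2) E, is_compatible_addition q xi lam add) /\
  (has_negatives X ->
   forall add : hom (Epow 2) E, is_compatible_addition q xi lam add ->
   exists neg : hom E E,
     is_abelian_group_bundle (D := BundleData q (Epow 2) add xi) neg).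
Proof.
have fpE2 : is_fibre_power q (Epow 2) := hpow 2 0.
have abT := tangent_bundle_additive (tstructP X) E.
have mono_lam : monic lam := lift_monic (n := 0) hpre hlam.
split=> [|[neg [neg_nat neg_grp]] add [ab_add am_lam _]].
  have [add [add_over am_lam]] := lift_addition_exists hpre fpE2 hlam.
  exists add; split=> [|add' [_ am_lam' _]].
    split=> //; last exact: (lift_additive_over_zero hpre (hpow 2) hlam).
    exact: (@additive_bundle_reflect _ (BundleData q (Epow 2) add xi) _ _ _
              fpE2 add_over (pdb_section hpre) abT mono_lam am_lam).
  apply: mono_lam; apply: (is_sum_unique (ab_pow2 abT)).
    exact: (am_add am_lam (is_sum_generic _)).
  exact: (am_add am_lam' (is_sum_generic _)).
have [n [lam_n q_n]] := lift_negation_exists hpre hlam neg_nat neg_grp.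
exists n; split=> //.
exact: (@negation_reflect _ (BundleData q (Epow 2) add xi) _ _ _ _ _
          fpE2 (ab_pow2 abT) mono_lam am_lam q_n lam_n (neg_grp E).2).
Qed.
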